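(* Suppose that $E=\bigsqcup_{n=1}^\infty E_n$ is a disjoint union of subsets of $\mathbb{R}$, where for each $n\in\mathbb{N}$ the set $E_n$ is closed and strongly one-sided dense. Then $E$ is $\operatorname{lip}1$.
   Context: For a continuous $f:\mathbb{R}\to\mathbb{R}$, $x\in\mathbb{R}$ and $r>0$ put $M_f(x,r)=\frac{1}{r}\sup\{|f(x)-f(y)|:|x-y|\le r\}$ and $\operatorname{lip} f(x)=\liminf_{r\to0^+}M_f(x,r)$. A set $E\subseteq\mathbb{R}$ is $\operatorname{lip}1$ if there is a continuous $f:\mathbb{R}\to\mathbb{R}$ with $\operatorname{lip} f=\mathbf{1}_E$ (the characteristic function of $E$). $|A|$ denotes the Lebesgue measure of $A$. A measurable set $S$ is strongly one-sided dense at $x$ if for every sequence $r_n\searrow0$ of positive numbers we have $\max\left\{\frac{|S\cap[x-r_n,x]|}{r_n},\frac{|S\cap[x,x+r_n]|}{r_n}\right\}\to1$; $S$ is strongly one-sided dense if it is strongly one-sided dense at every $x\in S$. *)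

(* Defs.v *)
From HB Require Import structures.
From mathcomp Require Import all_boot all_order all_algebra.
From mathcomp Require Import all_classical all_reals all_analysis.
Set Implicit Arguments.
Unset Strict Implicit.
Unset Printing Implicit Defensive.
Import Order.TTheory GRing.Theory Num.Theory.
Import numFieldNormedType.Exports.
Local Open Scope classical_set_scope.
Local Open Scope ring_scope.

(* The real-valued [sup] is the genuine supremum here: for continuous [f] and
   [0 < r] the set is nonempty (take [y = x]) and bounded, [f] being bounded
   on the compact interval [x - r, x + r]. *)
Definition Mf (R : realType) (f : R -> R) (x r : R) : R :=
  r^-1 * sup [set `|f x - f y| | y in [set y : R | `|x - y| <= r]].

(* Extended-real valued: the lower limit may be [+oo]. *)
Definition lip (R : realType) (f : R -> R) (x : R) : \bar R :=
  limf_einf (fun r : R => (Mf f x r)%:E) (0 : R)^'+.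

Definition lip1 (R : realType) (E : set R) : Prop :=
  exists f : R -> R, continuous f /\ forall x : R, lip f x = (\1_E x : R)%:E.

(* Meant for measurable [S]; measurability is not a conjunct, so it has to come
   from the context (e.g. from [S] being closed). *)
Definition strongly_one_sided_dense_at (R : realType) (S : set R) (x : R)
    : Prop :=
  forall r_ : R^nat,
    (forall n, 0 < r_ n) -> nonincreasing_seq r_ -> r_ @ \oo --> (0 : R) ->
    (maxe (lebesgue_measure (S `&` `[(x - r_ n)%R, x]) * ((r_ n)^-1)%R%:E)
          (lebesgue_measure (S `&` `[x, (x + r_ n)%R]) * ((r_ n)^-1)%R%:E))%E
      @[n --> \oo] --> (1 : \bar R)%E.

Definition strongly_one_sided_dense (R : realType) (S : set R) : Prop :=
  forall x : R, S x -> strongly_one_sided_dense_at S x.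

(* Main.v *)
(* Let [mu] be Lebesgue measure.  The function is a sum [f = \sum_n f_n] where
   [f_n] is a zigzag: it moves with slope 1 or -1 with respect to
   [cumul (E_ n)], the distribution function of [mu] restricted to [E_ n].
   The turning points are dyadic, locally finite off the earlier sets
   [E_ k], [k < n], and so close to one another near these sets that
   [0 <= f_n <= d_n / 2 ^+ n], with [d_n] the (truncated) distance to them.
   - The total variation of [f] on an interval is at most its length, so [f] is
     1-Lipschitz.
   - If [x \in E_ n], then [f_n] turns at no point near [x] other than [x]; when
     [E_ n] fills an interval [x, x + r] or [x - r, x] up to measure [o(r)], the
     other summands vary by [o(r)] only, so [f] varies by [r - o(r)].
   - If [x] is in no [E_ n], then within [d_n x / 2] of [x] the summands [f_k],
     [k < n], are constant and the others add up to [O(d_n x / 2 ^+ n)]. *)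
Require Import Defs.
From mathcomp Require Import all_boot all_order all_algebra.
From mathcomp Require Import all_classical all_reals all_analysis.
From mathcomp Require Import measurable_realfun ring lra.
Import Order.TTheory GRing.Theory Num.Theory.
Import numFieldNormedType.Exports.
Local Open Scope classical_set_scope.
Local Open Scope ring_scope.
Set Implicit Arguments.
Unset Strict Implicit.
Unset Printing Implicit Defensive.

(** * Distance to a set on the line, plain and truncated at 1 *)

Section Distance.
Variable R : realType.
Implicit Types (A B : set R) (x y u v : R).

Definition infdist A x : R := inf [set `|x - u| | u in A].

(** The element 1 gives the value 1 on the empty set, where a bare [inf] would give 0; this occurs
    when there is no earlier set. *)
Definition capdist A x : R := inf (1 |` [set `|x - u| | u in A]).

Lemma infdist_ge0 A x : 0 <= infdist A x.
Proof.
have [->|/set0P[a Aa]] := eqVneq A set0.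
  by rewrite /infdist image_set0 inf0.
apply: lb_le_inf; first by exists `|x - a|, a.
by move=> _ [u _ <-].
Qed.

Lemma infdist_le A x u : A u -> infdist A x <= `|x - u|.
Proof.
by move=> Au; apply: ge_inf; [exists 0 => _ [v _ <-]|exists u].
Qed.

Lemma le_infdist A x b : A !=set0 -> (forall u, A u -> b <= `|x - u|) ->
  b <= infdist A x.
Proof.
move=> [a Aa] bA; apply: lb_le_inf; first by exists `|x - a|, a.
by move=> _ [u Au <-]; exact: bA.
Qed.

Lemma infdist_lip A x y : `|infdist A x - infdist A y| <= `|x - y|.
Proof.
have [->|/set0P A0] := eqVneq A set0.
  by rewrite /infdist !image_set0 !inf0 subrr normr0.
suff H a b : infdist A a - `|a - b| <= infdist A b.
  by have := H x y; have := H y x; rewrite ler_norml (distrC y x); lra.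
apply: le_infdist => // u Au.
by have := infdist_le a Au; have := ler_distD b a u; lra.
Qed.

(* [e] is a sign: the point moves away from [s] to the right or to the left.
   Up to a small time no nearer point of [V] is met, so the distance to [V]
   either grows at unit speed, or decreases at unit speed when [V] has
   points ahead of [s] that (almost) realise the distance. *)
Lemma infdist_move (V : set R) (s e : R) : V !=set0 -> e = 1 \/ e = -1 ->
  exists2 t1 : R, 0 < t1 & forall t, 0 <= t -> t <= t1 ->
    (forall u, V u -> ~ (0 < e * (u - s) < t)) ->
    `|infdist V (s + e * t) - infdist V s| = t.
Proof.
move=> V0 e1; set D := infdist V s.
have normE u : (0 <= e * (u - s) /\ `|s - u| = e * (u - s)) \/
               (e * (u - s) <= 0 /\ `|s - u| = - (e * (u - s))).
  by case: e1 => ->; case: (lerP s u) => ?; [left|right|right|left]; lra.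
have lip t : 0 <= t -> `|infdist V (s + e * t) - D| <= t.
  move=> t0; apply: le_trans (infdist_lip _ _ _) _.
  by case: e1 => ->; rewrite ler_norml; lra.
(* Either points of [V] ahead of [s] realise [D] up to every [h], or some [h] keeps all points ahead
   of [s] at distance at least [D + h]. *)
have [ahead|] := pselect (forall h, 0 < h ->
    exists2 u, V u & 0 < e * (u - s) < D + h).
  exists 1 => // t t0 _ Vt.
  suff : infdist V (s + e * t) <= D - t.
    by have := lip t t0; rewrite ler_norml => ?; move=> ?; rewrite ler0_norm; lra.
  apply/ler_addgt0Pr => h /ahead[u Vu /andP[us uD]].
  have tu : t <= e * (u - s).
    by rewrite leNgt; apply/negP => ut; apply: (Vt u Vu); rewrite us ut.
  apply: le_trans (infdist_le _ Vu) _.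
  by move: us uD tu; case: e1 => -> us uD tu; rewrite ler_norml; lra.
move=> /existsNP[h /not_implyP[h0 noahead]].
(* Points ahead remain at distance at least [D + h - t], which is at least [D + t] when
   [t <= h / 2]; the others recede. *)
exists (h / 2); first lra.
move=> t t0 th _.
suff : D + t <= infdist V (s + e * t).
  by have := lip t t0; rewrite ler_norml => ?; move=> ?; rewrite ger0_norm; lra.
apply: le_infdist => // u Vu.
have Du : D <= `|s - u| by exact: infdist_le.
have [us|us] := ltP 0 (e * (u - s)).
  have hu : D + h <= e * (u - s).
    by rewrite leNgt; apply/negP => uh; apply: noahead; exists u; rewrite ?us.
  rewrite ler_normr; apply/orP.
  by move: us hu; case: e1 => -> us hu; [right|left]; lra.
have {}Du : D <= - (e * (u - s)) by case: (normE u) => -[] *; lra.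
rewrite ler_normr; apply/orP.
by move: us Du; case: e1 => -> us Du; [left|right]; lra.
Qed.

Lemma capdist_has_lbound A x : has_lbound (1 |` [set `|x - u| | u in A]).
Proof. by exists 0 => _ [->|[v _ <-]]. Qed.

Lemma le_capdist A x b : b <= 1 -> (forall u, A u -> b <= `|x - u|) ->
  b <= capdist A x.
Proof.
move=> b1 bA; apply: lb_le_inf; first by exists 1; left.
by move=> _ [->|[u Au <-]] //; exact: bA.
Qed.

Lemma capdist_ge0 A x : 0 <= capdist A x.
Proof. exact: le_capdist. Qed.

Lemma capdist_le1 A x : capdist A x <= 1.
Proof. by apply: ge_inf; [exact: capdist_has_lbound|left]. Qed.

Lemma capdist_le A x u : A u -> capdist A x <= `|x - u|.
Proof.
by move=> Au; apply: ge_inf; [exact: capdist_has_lbound|right; exists u].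
Qed.

Lemma capdist_lip A x y : capdist A x <= capdist A y + `|x - y|.
Proof.
rewrite -lerBlDr; apply: le_capdist => [|u Au].
  by have := capdist_le1 A x; have := normr_ge0 (x - y); lra.
by have := capdist_le x Au; have := ler_distD y x u; lra.
Qed.

Lemma capdist_anti A B x : A `<=` B -> capdist B x <= capdist A x.
Proof.
move=> AB; apply: le_capdist => [|u /AB]; first exact: capdist_le1.
exact: capdist_le.
Qed.

Lemma capdist_gt0 A x : closed A -> ~ A x -> 0 < capdist A x.
Proof.
move=> Acl Ax; have : open_nbhs x (~` A) by split => //; exact: closed_openC.
move=> /open_nbhs_nbhs /nbhs_ballP[e /= e0 eA].
apply: lt_le_trans (_ : Num.min 1 e <= _); first by rewrite lt_min ltr01 e0.
apply: le_capdist => [|u Au]; first by rewrite ge_min lexx.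
rewrite ge_min; apply/orP; right; rewrite leNgt; apply/negP => xu.
by apply: (eA u).
Qed.

End Distance.

(** * Lebesgue mass of a set on segments, and its distribution function *)

Section Mass.
Variable R : realType.
Implicit Types (A : set R) (a b c : R).
Local Notation mu := (@lebesgue_measure R).

Definition mass A a b : R := fine (mu (A `&` `[a, b])).

Lemma lebesgue_measure_segment a b : a <= b -> mu `[a, b] = (b - a)%:E.
Proof.
rewrite lebesgue_measure_itv /= lte_fin le_eqVlt => /predU1P[->|->].
  by rewrite ltxx subrr.
by rewrite EFinB.
Qed.

Lemma mass_fin_num A a b : measurable A -> mu (A `&` `[a, b]) \is a fin_num.
Proof.
move=> mA; rewrite ge0_fin_numE ?measure_ge0//.
apply: le_lt_trans (_ : mu `[a, b] < +oo)%E.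
  by apply: le_measure; rewrite ?inE//; exact: measurableI.
have [ab|ba] := leP a b; first by rewrite lebesgue_measure_segment ?ltry.
by rewrite set_itv_ge ?bnd_simp -?ltNge// measure0 ltry.
Qed.

Lemma mass_ge0 A a b : 0 <= mass A a b.
Proof. by rewrite fine_ge0. Qed.

Lemma mass_eq0 A a b : A `&` `[a, b] = set0 -> mass A a b = 0.
Proof. by rewrite /mass => ->; rewrite measure0. Qed.

Lemma mass_ge A a b : measurable A -> b <= a -> mass A a b = 0.
Proof.
move=> mA ba; rewrite /mass; suff -> : mu (A `&` `[a, b]) = 0%E by [].
apply/eqP; rewrite eq_le measure_ge0 andbT.
rewrite -(@lebesgue_measure_set1 R a); apply: le_measure; rewrite ?inE//.
  exact: measurableI.
by move=> u [_] /=; rewrite in_itv/= => /andP[au ub]; apply/eqP; rewrite eq_le; lra.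
Qed.

Lemma massD A a b c : measurable A -> a <= b -> b <= c ->
  mass A a c = mass A a b + mass A b c.
Proof.
move=> mA ab bc.
(* The two segments share the point [b], which is null. *)
have mE : mu (A `&` `[b, c]) = mu (A `&` `]b, c]).
  apply/eqP; rewrite eq_le; apply/andP; split; last first.
    apply: le_measure; rewrite ?inE; [exact: measurableI|exact: measurableI|].
    by apply: setIS => u /=; rewrite !in_itv/= => /andP[/ltW -> ->].
  rewrite -[leRHS]add0e -(@lebesgue_measure_set1 R b).
  apply: le_trans (_ : mu ([set b] `|` A `&` `]b, c]) <= _)%E.
    apply: le_measure; rewrite ?inE; [exact: measurableI| |].
      by apply: measurableU => //; exact: measurableI.
    move=> u [Au] /=; rewrite !in_itv/= => /andP[].
    by rewrite le_eqVlt => /predU1P[->|bu uc]; [left|right; rewrite bu].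
  by apply: measureU2 => //; exact: measurableI.
rewrite /mass -fineD ?mass_fin_num//.
congr (fine _); rewrite mE -measureU; [|exact: measurableI|exact: measurableI|].
- congr (mu _); rewrite -setIUr; congr (_ `&` _).
  apply/seteqP; split=> u /=; rewrite !in_itv/=.
    by move=> /andP[au uc]; have [|] := leP u b; [left|right]; rewrite ?au ?uc.
  by move=> [|] /andP[]; lra.
- apply/seteqP; split=> u //= [[_]] /=; rewrite in_itv/= => /andP[_ ub] [_].
  by rewrite in_itv/= => /andP[]; lra.
Qed.

(** The traces of the sets on the segment are disjoint. This is what bounds the total variation of
    the sum of zigzags. *)
Lemma mass_sum_le (E_ : nat -> set R) N a b : trivIset setT E_ ->
  (forall n, measurable (E_ n)) -> a <= b ->
  \sum_(n < N) mass (E_ n) a b <= b - a.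
Proof.
move=> tE mE ab.
rewrite -lee_fin -sumEFin.
rewrite -(lebesgue_measure_segment ab).
under eq_bigr do rewrite fineK ?mass_fin_num//.
rewrite -(@measure_semi_additive_ord_I _ _ _ mu (fun n => E_ n `&` `[a, b])).
- apply: le_measure; rewrite ?inE//.
    by apply: bigsetU_measurable => k _; apply: measurableI => //; exact: mE.
  by rewrite -(bigcup_mkord N (fun n => E_ n `&` `[a, b])) => u [k _ []].
- by move=> k _; apply: measurableI => //; exact: mE.
- by apply/trivIsetP => i j _ _ ij; move/trivIsetP: tE => /(_ i j I I ij);
    rewrite -!subset0 => H u [[? _] [? _]]; apply: H.
- by apply: bigsetU_measurable => k _; apply: measurableI => //; exact: mE.
Qed.

(** Signed distribution function vanishing at 0: [mass] is 0 on a reversed segment, so for each sign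
    of [x] a single term counts. *)
Definition cumul A x : R := mass A 0 x - mass A x 0.

Lemma cumulB A a b : measurable A -> a <= b ->
  cumul A b - cumul A a = mass A a b.
Proof.
move=> mA ab; rewrite /cumul.
have [a0|/ltW a0] := leP 0 a.
  by rewrite (massD mA a0 ab) !(@mass_ge A _ 0)//; lra.
have [b0|/ltW b0] := leP 0 b.
  by rewrite (massD mA a0 b0) (@mass_ge A 0 a) ?(@mass_ge A b 0)//; lra.
by rewrite (massD mA ab b0) !(@mass_ge A 0 _)//; lra.
Qed.

Lemma cumul_le A a b : measurable A -> a <= b -> cumul A a <= cumul A b.
Proof. by move=> mA ab; rewrite -subr_ge0 cumulB// mass_ge0. Qed.

Lemma mass_le A a b : measurable A -> a <= b -> mass A a b <= b - a.
Proof.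
move=> mA ab; rewrite -lee_fin fineK ?mass_fin_num//.
rewrite -lebesgue_measure_segment//; apply: le_measure; rewrite ?inE//.
exact: measurableI.
Qed.

Lemma cumul_lip A a b : measurable A -> `|cumul A a - cumul A b| <= `|a - b|.
Proof.
move=> mA; wlog ab : a b / a <= b => [H|].
  have [/H//|/ltW/H] := leP a b.
  by rewrite distrC (distrC b).
by rewrite distrC cumulB// ger0_norm ?mass_ge0// distrC ger0_norm ?subr_ge0//
  mass_le.
Qed.

End Mass.

(** * Dyadic turning points *)

Section Nodes.
Variable R : realType.
Implicit Types (D : R -> R) (C x y z : R).

Lemma exists_half_expn_lt (e : R) : 0 < e -> exists j : nat, 1 / 2 ^+ j < e.
Proof.
move=> e0; exists (Num.bound e^-1).
rewrite ltr_pdivrMr ?exprn_gt0// -ltr_pdivrMl// mulr1.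
apply: lt_le_trans (archi_boundP _) _; first by rewrite invr_ge0 ltW.
by rewrite -natrX ler_nat ltnW// ltn_expl.
Qed.

(* Dyadic points, the finer the closer to the zero set of [D]. *)
Definition nodes C D : set R :=
  [set z | D z = 0 \/ exists (j : nat) (k : int),
    z = k%:~R / 2 ^+ j /\ D z <= C / 2 ^+ j].

(** Round [y] down to the coarsest dyadic mesh [1 / 2 ^+ j] that is at most [h = D y / 2 ^+ n].
    Coarsest means [h < 2 / 2 ^+ j] unless [j = 0], so [D y <= 2 ^+ n.+1 / 2 ^+ j]; from [y] to [z]
    the value of [D] grows by at most one mesh, hence the summand 1 in the constant. *)
Lemma nodes_dense (n : nat) D y : (forall x, 0 <= D x) -> (forall x, D x <= 1) ->
  (forall x z, D x <= D z + `|x - z|) ->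
  exists2 z, nodes (2 ^+ n.+1 + 1) D z & `|y - z| <= D y / 2 ^+ n.
Proof.
move=> D0 D1 Dlip.
have n2 : (0 : R) < 2 ^+ n by rewrite exprn_gt0.
have := D0 y; rewrite le_eqVlt => /predU1P[/esym Dy0|Dy].
  by exists y; [left|rewrite Dy0 subrr normr0 mul0r].
set h := D y / 2 ^+ n; have h0 : 0 < h by rewrite divr_gt0.
have hE : D y = 2 ^+ n * h by rewrite /h mulrC divfK// gt_eqF.
have /ex_minnP[j jh jmin] : exists j : nat, 1 / 2 ^+ j <= h.
  by have [j /ltW] := exists_half_expn_lt h0; exists j.
have j2 : (0 : R) < 2 ^+ j by rewrite exprn_gt0.
set k := Num.floor (y * 2 ^+ j).
have /andP[k1 k2] := real_floor_itv (num_real (y * 2 ^+ j)).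
rewrite -/k intrD in k1 k2.
have dist : `|y - k%:~R / 2 ^+ j| <= 1 / 2 ^+ j.
  have -> : y - k%:~R / 2 ^+ j = (y * 2 ^+ j - k%:~R) / 2 ^+ j.
    by rewrite mulrBl mulfK// gt_eqF.
  rewrite normrM normfV (gtr0_norm j2) ler_pM2r ?invr_gt0//.
  by rewrite ler_norml; lra.
exists (k%:~R / 2 ^+ j); last exact: le_trans dist jh.
right; exists j, k; split => //.
have Dz : D (k%:~R / 2 ^+ j) <= D y + 1 / 2 ^+ j.
  by apply: le_trans (Dlip _ y) _; rewrite distrC lerD2l.
(* For [j = 0] minimality says nothing, but [D <= 1] suffices. *)
have [j0|j0] := posnP j.
  apply: le_trans (D1 _) _.
  by rewrite j0 expr0 divr1 lerDr exprn_ge0.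
apply: le_trans Dz _; rewrite mulrDl lerD2r hE exprS.
have : h < 2 / 2 ^+ j.
  rewrite ltNge; apply/negP => hj.
  have := jmin j.-1; rewrite -subn1.
  suff -> : 1 / 2 ^+ (j - 1) = 2 / 2 ^+ j :> R.
    by move=> /(_ hj); rewrite leqNgt subn1 ltn_predL j0.
  by rewrite -{2}(subnK j0) exprD expr1 invfM mulrCA mulfV ?mulr1// div1r.
by move=> /ltW hj; rewrite (mulrC 2) -mulrA ler_pM2l.
Qed.

(** Near [x] the function [D] stays above [D x / 2], which bounds the level [j] of a node; all nodes
    there lie in one lattice of mesh [1 / 2 ^+ J]. *)
Lemma nodes_isolated C D x : 0 < C -> 0 < D x ->
  (forall x z, D x <= D z + `|x - z|) ->
  exists2 e, 0 < e & forall z, nodes C D z -> `|x - z| < e -> z = x.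
Proof.
move=> C0 Dx Dlip.
have [J HJ] : exists j : nat, 1 / 2 ^+ j < D x / 2 / C.
  by apply: exists_half_expn_lt; rewrite !divr_gt0.
have J2 : (0 : R) < 2 ^+ J by rewrite exprn_gt0.
pose m := x * 2 ^+ J.
have /andP[k1 k2] := real_floor_itv (num_real m).
have /andP[c1 c2] := real_ceil_itv (num_real m).
set k := Num.floor m in k1 k2; set c := Num.ceil m in c1 c2.
rewrite intrD in k2; rewrite intrB in c1.
(* The last two terms are the distances from [x] to the nearest lattice points strictly to its right
   and left, hence positive even if [x] is a lattice point. *)
pose e := Num.min (D x / 2) (Num.min ((k%:~R + 1 - m) / 2 ^+ J)
  ((m - (c%:~R - 1)) / 2 ^+ J)).
exists e; first by rewrite !lt_min !divr_gt0// subr_gt0.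
move=> z Zz; rewrite !lt_min => /and3P[zD zk zc].
have Dz : D x / 2 < D z by have := Dlip x z; lra.
case: Zz => [|[j [i [zE zj]]]]; first by lra.
have jJ : (j <= J)%N.
  rewrite leqNgt; apply/negP => Jj.
  have : 1 / 2 ^+ j <= (1 / 2 ^+ J : R).
    by rewrite ler_pM2l// lef_pV2 ?posrE ?exprn_gt0// ler_eXn2l ?ltr1n// ltnW.
  have : D x / 2 / C < 1 / 2 ^+ j.
    by rewrite ltr_pdivrMr//; apply: lt_le_trans Dz _; rewrite mulrC mulrA mulr1.
  by lra.
have [i' zE'] : exists i' : int, z * 2 ^+ J = i'%:~R.
  exists (i * 2 ^+ (J - j)); rewrite zE intrM -(subnK jJ) exprD addnK.
  by rewrite mulrCA mulfVK ?gt_eqF ?exprn_gt0// rmorphXn/= mulrC.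
have xz : x - z = (m - i'%:~R) / 2 ^+ J.
  by rewrite -zE' /m -mulrBl mulfK// gt_eqF.
move: zk zc; rewrite xz normrM normfV (gtr0_norm J2) !ltr_pM2r ?invr_gt0// => zk zc.
suff /eqP : m = i'%:~R.
  by rewrite -zE' /m -subr_eq0 -mulrBl mulf_eq0 (gt_eqF J2) orbF subr_eq0 => /eqP.
apply/eqP; rewrite eq_le; apply/andP; split.
  have : (c - 1 < i')%R by rewrite -(ltr_int R) intrB; move: zc; rewrite ltr_norml; lra.
  by rewrite ltrBlDr ltzD1 -(ler_int R); lra.
have : (i' < k + 1)%R by rewrite -(ltr_int R) intrD; move: zk; rewrite ltr_norml; lra.
by rewrite ltzD1 -(ler_int R); lra.
Qed.

End Nodes.

(** * Criteria for [lip] to be 0 or 1, for 1-Lipschitz functions *)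

Section Lip.
Variables (R : realType) (f : R -> R).
Hypothesis f_lip : forall x y, `|f x - f y| <= `|x - y|.

Lemma Mf_le x r c : 0 < r ->
  (forall y, `|x - y| <= r -> `|f x - f y| <= c * r) -> Mf f x r <= c.
Proof.
move=> r0 fc; rewrite /Mf ler_pdivrMl// mulrC; apply: ge_sup.
  by exists `|f x - f x|, x => //=; rewrite subrr normr0 ltW.
by move=> _ [y xy <-]; exact: fc.
Qed.

(** [f_lip] bounds the set of increments by [r], so its [sup] is an upper bound. *)
Lemma Mf_ge x y r c : 0 < r -> `|x - y| <= r -> c * r <= `|f x - f y| ->
  c <= Mf f x r.
Proof.
move=> r0 xy cf; rewrite /Mf ler_pdivlMl// mulrC; apply: le_trans cf _.
apply: ub_le_sup; last by exists y.
by exists r => _ [z /= xz <-]; exact: le_trans (f_lip _ _) xz.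
Qed.

Lemma lip_ge x c : (exists2 d, 0 < d & forall r, 0 < r -> r < d -> c <= Mf f x r) ->
  (c%:E <= lip f x)%E.
Proof.
move=> [d d0 cM]; rewrite /lip limf_einfE.
have Vd : (0 : R)^'+ [set` `]0, d[].
  exists d => //= r /=; rewrite sub0r normrN => rd r0.
  by rewrite in_itv/= r0 -[ltLHS](gtr0_norm r0).
apply: le_ereal_sup_tmp.
exists (ereal_inf ((fun r => (Mf f x r)%:E) @` [set` `]0, d[])).
  by exists [set` `]0, d[].
apply: le_ereal_inf_tmp => _ [r /= /[!in_itv]/= /andP[r0 rd] <-].
by rewrite lee_fin; exact: cM.
Qed.

Lemma lip_le x c :
  (forall d, 0 < d -> exists r, [/\ 0 < r, r < d & Mf f x r <= c]) ->
  (lip f x <= c%:E)%E.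
Proof.
move=> Mc; rewrite /lip limf_einfE.
apply: ge_ereal_sup => _ [V [d /= d0 dV] <-].
have [r [r0 rd Mr]] := Mc d d0.
apply: ge_ereal_inf; exists (Mf f x r)%:E; last by rewrite lee_fin.
by exists r => //; apply: dV => //=; rewrite sub0r normrN gtr0_norm.
Qed.

(** For a lower limit, arbitrarily small good radii suffice; a single [e] bounds both the radius and
    the quotient. *)
Lemma lip_eq0 x :
  (forall e, 0 < e -> exists r, [/\ 0 < r, r < e &
    forall y, `|x - y| <= r -> `|f x - f y| <= e * r]) ->
  lip f x = 0%:E.
Proof.
move=> H; apply/eqP; rewrite eq_le; apply/andP; split.
  apply/lee_addgt0Pr => e e0; rewrite add0e; apply: lip_le => d d0.
  have [|r [r0 red Hr]] := H (Num.min e d); first by rewrite lt_min e0.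
  exists r; split => //; first by move: red; rewrite lt_min => /andP[].
  apply: Mf_le => // y xy; apply: le_trans (Hr y xy) _.
  by rewrite ler_pM2r// ge_min lexx.
apply: lip_ge; exists 1 => // r r0 _.
by apply: (@Mf_ge x x) => //; rewrite !subrr normr0 ?mul0r// ltW.
Qed.

Lemma lip_eq1 x :
  (forall e, 0 < e -> exists2 d, 0 < d & forall r, 0 < r -> r < d ->
    exists2 y, `|x - y| <= r & (1 - e) * r <= `|f x - f y|) ->
  lip f x = 1%:E.
Proof.
move=> H; apply/eqP; rewrite eq_le; apply/andP; split.
  apply: lip_le => d d0; exists (d / 2); split; [lra|lra|].
  apply: Mf_le => [|y xy]; first lra.
  by rewrite mul1r; exact: le_trans (f_lip _ _) xy.
apply/lee_subgt0Pr => e e0; rewrite -EFinB; apply: lip_ge.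
have [d d0 Hd] := H e e0; exists d => // r r0 rd.
have [y xy fy] := Hd r r0 rd.
exact: Mf_ge xy fy.
Qed.

End Lip.

(** * One-sided density in epsilon-delta form *)

Section Density.
Variable R : realType.

(** If it fails for [e], bad radii exist below every bound; taking each below half of the previous
    one gives a decreasing null sequence along which both ratios stay under [1 - e]. *)
Lemma strongly_one_sided_dense_mass (A : set R) x : measurable A ->
  strongly_one_sided_dense_at A x -> forall e, 0 < e ->
  exists2 d, 0 < d & forall r, 0 < r -> r < d ->
    (1 - e) * r <= mass A (x - r) x \/ (1 - e) * r <= mass A x (x + r).
Proof.
move=> mA Ax e e0; apply: contrapT => nd.
(* The condition [0 < d] stands under the quantifier so that [choice] applies; for other [d] the
   radius is arbitrary. *)
have bad d : exists r, 0 < d -> [/\ 0 < r, r < d,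
    mass A (x - r) x < (1 - e) * r & mass A x (x + r) < (1 - e) * r].
  have [d0|] := pselect (0 < d); last by exists 0.
  apply: contrapT => nr; apply: nd; exists d => // r r0 rd.
  have [|H1] := leP ((1 - e) * r) (mass A (x - r) x); first by left.
  have [|H2] := leP ((1 - e) * r) (mass A x (x + r)); first by right.
  by exfalso; apply: nr; exists r.
have [h hP] := choice bad.
pose r_ n := iter n (fun t => h (t / 2)) (h 1).
have r0 n : 0 < r_ n.
  elim: n => [|n IH]; first by have [] := hP 1 ltr01.
  by have [] := hP (r_ n / 2) ltac:(by rewrite divr_gt0).
have rS n : r_ n.+1 < r_ n / 2.
  by have [] := hP (r_ n / 2) ltac:(by rewrite divr_gt0).
have rbad n : mass A (x - r_ n) x < (1 - e) * r_ n /\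
    mass A x (x + r_ n) < (1 - e) * r_ n.
  case: n => [|n]; first by have [] := hP 1 ltr01.
  by have [] := hP (r_ n / 2) ltac:(by rewrite divr_gt0).
have rni : nonincreasing_seq r_.
  by apply/nonincreasing_seqP => n; have := rS n; have := r0 n; lra.
have rle n : r_ n <= r_ 0 / 2 ^+ n.
  elim: n => [|n IH]; first by rewrite expr0 divr1.
  apply: le_trans (ltW (rS n)) _.
  by rewrite exprSr invfM mulrA ler_pM2r// invr_gt0.
have rcvg : r_ @ \oo --> (0 : R).
  apply: (@squeeze_cvgr _ _ _ _ (fun=> 0) (geometric (r_ 0) 2^-1)).
  - near=> n; rewrite ltW ?r0//=; apply: le_trans (rle n) _.
    by rewrite exprVn.
  - exact: cvg_cst.
  - by apply: cvg_geometric; rewrite ger0_norm; lra.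
have /fine_cvgP := Ax r_ r0 rni rcvg.
move=> [_] /cvgr_gt /(_ (1 - e)); rewrite /= => /(_ ltac:(lra)).
move=> [N _ /(_ N (leqnn N))] /=.
have [H1 H2] := rbad N.
rewrite -(fineK (mass_fin_num (x - r_ N) x mA)).
rewrite -(fineK (mass_fin_num x (x + r_ N) mA)).
rewrite -/(mass _ _ _) -/(mass _ _ _) -!EFinM -EFin_max /= lt_max !ltr_pdivlMr ?r0//.
by case/orP; lra.
Unshelve. all: by end_near. Qed.

End Density.

(** * The zigzags and their sum *)

Section ZigzagSum.
Variables (R : realType) (E_ : nat -> set R).
Hypothesis E_disjoint : trivIset setT E_.
Hypothesis E_closed : forall n, closed (E_ n).
Implicit Types (x y c : R) (n k N : nat).

Let E_meas n : measurable (E_ n). Proof. exact: closed_measurable. Qed.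

Definition gap n : R -> R := capdist (\bigcup_(k in `I_n) E_ k).

(** Distances are taken between values of [cumul (E_ n)], so slopes are relative to the mass of
    [E_ n], and the function is constant on intervals that miss [E_ n]. *)
Definition zigzag n x : R :=
  infdist (cumul (E_ n) @` nodes (2 ^+ n.+1 + 1) (gap n)) (cumul (E_ n) x).

Definition zigzag_sum x : R := limn (series (zigzag ^~ x)).

Let nodes0 n : nodes (2 ^+ n.+1 + 1) (gap n) !=set0.
Proof.
have [z Zz _] := @nodes_dense R n (gap n) 0 (@capdist_ge0 _ _) (@capdist_le1 _ _)
  (@capdist_lip _ _).
by exists z.
Qed.

Lemma zigzag_ge0 n x : 0 <= zigzag n x.
Proof. exact: infdist_ge0. Qed.

(** A node lies within this distance of [x], and [cumul] does not increase distances. *)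
Lemma zigzag_le n x : zigzag n x <= gap n x / 2 ^+ n.
Proof.
have [z Zz xz] := @nodes_dense R n (gap n) x (@capdist_ge0 _ _)
  (@capdist_le1 _ _) (@capdist_lip _ _).
apply: le_trans xz; apply: le_trans (cumul_lip _ _ (E_meas n)).
by apply: infdist_le; exists z.
Qed.

Lemma zigzag_lip n x y :
  `|zigzag n x - zigzag n y| <= `|cumul (E_ n) x - cumul (E_ n) y|.
Proof. exact: infdist_lip. Qed.

(** By disjointness [x] is off the earlier sets, whose union is closed, so [gap n x > 0] and no node
    other than [x] is near; [infdist_move] then applies in both directions. *)
Lemma zigzag_move n x : E_ n x ->
  exists2 d, 0 < d & forall y, `|x - y| <= d ->
    `|zigzag n y - zigzag n x| = `|cumul (E_ n) y - cumul (E_ n) x|.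
Proof.
move=> Enx; set g := cumul (E_ n).
have gap_x : 0 < gap n x.
  apply: capdist_gt0 => [|[k /= kn Ekx]].
    by apply: closed_bigcup => // k _; exact: E_closed.
  by move: kn; rewrite (E_disjoint I I (ex_intro _ x (conj Ekx Enx))) ltnn.
have C0 : (0 : R) < 2 ^+ n.+1 + 1 by rewrite addr_gt0 ?exprn_gt0.
have [e e0 Ze] := nodes_isolated C0 gap_x (@capdist_lip _ _).
have V0 : g @` nodes (2 ^+ n.+1 + 1) (gap n) !=set0.
  by have [z Zz] := nodes0 n; exists (g z), z.
have [t1 t10 H1] := infdist_move (g x) V0 (or_introl erefl : (1 : R) = 1 \/ _).
have [t2 t20 H2] := infdist_move (g x) V0 (or_intror erefl : _ \/ -1 = -1 :> R).
exists (Num.min (e / 2) (Num.min t1 t2)); first by rewrite !lt_min t10 t20 divr_gt0.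
move=> y; rewrite !le_min => /and3P[ye y1 y2].
have gl := cumul_lip x y (E_meas n); rewrite -/g in gl.
have [xy|/ltW yx] := leP x y.
  have gxy : g x <= g y by exact: cumul_le.
  have gE : `|g y - g x| = g y - g x by rewrite ger0_norm// subr_ge0.
  have yE : g x + 1 * `|g y - g x| = g y by rewrite gE; ring.
  have := H1 `|g y - g x|; rewrite yE; apply => //.
    by rewrite distrC (le_trans gl).
  move=> _ [z Zz <-]; rewrite gE => /andP[zx zy].
  (* As [cumul] is monotone, a node value strictly between [g x] and [g y] comes from a node
     strictly between [x] and [y]. *)
  have xz : x < z.
    rewrite ltNge; apply/negP => zx'; have := cumul_le (E_meas n) zx'.
    by rewrite -/g; lra.
  have zy' : z < y.
    rewrite ltNge; apply/negP => zy'; have := cumul_le (E_meas n) zy'.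
    by rewrite -/g; lra.
  have /Ze : `|x - z| < e.
    by move: ye; rewrite ler_norml => ye; rewrite ltr_norml; lra.
  by move=> /(_ Zz); lra.
have gxy : g y <= g x by exact: cumul_le.
have gE : `|g y - g x| = g x - g y by rewrite distrC ger0_norm// subr_ge0.
have yE : g x + -1 * `|g y - g x| = g y by rewrite gE; ring.
have := H2 `|g y - g x|; rewrite yE; apply => //; first by rewrite distrC (le_trans gl).
move=> _ [z Zz <-]; rewrite gE => /andP[zx zy].
have xz : z < x.
  rewrite ltNge; apply/negP => zx'; have := cumul_le (E_meas n) zx'.
  by rewrite -/g; lra.
have zy' : y < z.
  rewrite ltNge; apply/negP => zy'; have := cumul_le (E_meas n) zy'.
  by rewrite -/g; lra.
have /Ze : `|x - z| < e.
  by move: ye; rewrite ler_norml => ye; rewrite ltr_norml; lra.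
by move=> /(_ Zz); lra.
Qed.

Lemma is_cvg_zigzag x : cvgn (series (zigzag ^~ x)).
Proof.
apply: (@series_le_cvg _ _ (geometric 1 2^-1)).
- by move=> n; exact: zigzag_ge0.
- by move=> n; rewrite /= mul1r exprn_ge0.
- move=> n; apply: le_trans (zigzag_le n x) _.
  by rewrite /= exprVn ler_pM2r ?invr_gt0 ?exprn_gt0// capdist_le1.
- by apply: is_cvg_geometric_series; rewrite ger0_norm; lra.
Qed.

Let cvg_diff x y :
  `|\sum_(k < N) (zigzag k x - zigzag k y)| @[N --> \oo]
    --> `|zigzag_sum x - zigzag_sum y|.
Proof.
have -> : (fun N => `|\sum_(k < N) (zigzag k x - zigzag k y)|) =
    (fun N => `|(series (zigzag ^~ x) \- series (zigzag ^~ y)) N|).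
  by apply/funext => N; rewrite /series /= !big_mkord sumrB.
apply: cvg_norm; exact: cvgB (@is_cvg_zigzag x) (@is_cvg_zigzag y).
Qed.

Lemma zigzag_sum_diff_le x y c n :
  (forall N, (n <= N)%N -> `|\sum_(k < N) (zigzag k x - zigzag k y)| <= c) ->
  `|zigzag_sum x - zigzag_sum y| <= c.
Proof.
move=> H; apply: (@cvgr_to_le _ _ _ _ _ _ _ (@cvg_diff x y)).
by near=> N; apply: H; near: N; exact: nbhs_infty_ge.
Unshelve. all: by end_near. Qed.

Lemma zigzag_sum_diff_ge x y c n :
  (forall N, (n <= N)%N -> c <= `|\sum_(k < N) (zigzag k x - zigzag k y)|) ->
  c <= `|zigzag_sum x - zigzag_sum y|.
Proof.
move=> H; apply: (@cvgr_to_ge _ _ _ _ _ _ _ (@cvg_diff x y)).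
by near=> N; apply: H; near: N; exact: nbhs_infty_ge.
Unshelve. all: by end_near. Qed.

Let sum_cumul_le N x y :
  \sum_(k < N) `|cumul (E_ k) x - cumul (E_ k) y| <= `|x - y|.
Proof.
wlog xy : x y / x <= y => [H|].
  have [/H//|/ltW/H] := leP x y.
  by rewrite distrC; under eq_bigr do rewrite distrC.
rewrite distrC ger0_norm ?subr_ge0//.
apply: le_trans (mass_sum_le N E_disjoint E_meas xy).
by apply: ler_sum => k _; rewrite distrC cumulB// ger0_norm// mass_ge0.
Qed.

Lemma zigzag_sum_lip x y : `|zigzag_sum x - zigzag_sum y| <= `|x - y|.
Proof.
apply: (@zigzag_sum_diff_le _ _ _ 0) => N _.
apply: le_trans (sum_cumul_le N x y); apply: le_trans (ler_norm_sum _ _ _) _.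
by apply: ler_sum => k _; exact: zigzag_lip.
Qed.

(* The other sets only have room for [`|x - y| - m] of mass between [x] and [y],
   where [m] is the mass of [E_ n]. *)
Lemma zigzag_sum_ge n x : E_ n x ->
  exists2 d, 0 < d & forall y, `|x - y| <= d ->
    2 * `|cumul (E_ n) x - cumul (E_ n) y| - `|x - y| <=
    `|zigzag_sum x - zigzag_sum y|.
Proof.
move=> /zigzag_move[d d0 Hd]; exists d => // y /Hd; rewrite distrC => zE.
(* From [n.+1] on, the partial sums contain the term of index [n]. *)
apply: (@zigzag_sum_diff_ge _ _ _ n.+1) => N nN.
have := sum_cumul_le N x y.
rewrite (bigD1 (Ordinal nN))//= [in X in _ -> X](bigD1 (Ordinal nN))//=.
set s := \sum_(_ < _ | _) _; set t := \sum_(_ < _ | _) _ => cs.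
have ts : `|t| <= s.
  apply: le_trans (ler_norm_sum _ _ _) _.
  by apply: ler_sum => k _; exact: zigzag_lip.
have := lerB_normD (zigzag n x - zigzag n y) t.
rewrite zE distrC; lra.
Qed.

Let sum_half_expn n N : (n <= N)%N ->
  \sum_(n <= k < N) 1 / 2 ^+ k <= (2 / 2 ^+ n : R).
Proof.
move=> nN; suff -> : \sum_(n <= k < N) 1 / 2 ^+ k = (2 / 2 ^+ n - 2 / 2 ^+ N : R).
  by rewrite gerBl divr_ge0// exprn_ge0.
elim: N nN => [|N IH]; first by rewrite leqn0 => /eqP ->; rewrite big_geq// subrr.
rewrite leq_eqVlt => /predU1P[->|nN]; first by rewrite big_geq// subrr.
rewrite big_nat_recr//= IH// exprS; field.
by rewrite !expf_neq0.
Qed.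

(** Summands before [n] agree at [x] and [y], as the segment between them misses the earlier sets.
    The others lie between 0 and [B / 2 ^+ k], since [gap] is nonincreasing in its index. [B] is
    left free to be [2 * gap m x] or 1. *)
Lemma zigzag_sum_diff_gap n x y B : `|x - y| < gap n x ->
  gap n x <= B -> gap n y <= B ->
  `|zigzag_sum x - zigzag_sum y| <= B * (2 / 2 ^+ n).
Proof.
move=> xy gx gy.
have zle k u : (n <= k)%N -> gap n u <= B -> zigzag k u <= B / 2 ^+ k.
  move=> nk gu; apply: le_trans (zigzag_le k u) _.
  rewrite ler_pM2r ?invr_gt0 ?exprn_gt0//; apply: le_trans gu.
  by apply: capdist_anti => v [i /= ni Ei]; exists i => //=; exact: leq_trans nk.
have z0 k : (k < n)%N -> zigzag k x = zigzag k y.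
  move=> kn; apply/eqP; rewrite -subr_eq0 -normr_le0.
  apply: le_trans (zigzag_lip _ _ _) _; rewrite normr_le0 subr_eq0.
  have far u : E_ k u -> gap n x <= `|x - u|.
    by move=> Eu; apply: capdist_le; exists k.
  have := xy; rewrite ltr_norml => /andP[yx xy'].
  have [le_xy|/ltW le_yx] := leP x y.
    rewrite eq_sym -subr_eq0 cumulB// mass_eq0//.
    apply/seteqP; split=> u //= [/far + /[!in_itv]/= /andP[xu uy]].
    by rewrite ler_normr => /orP[]; lra.
  rewrite -subr_eq0 cumulB// mass_eq0//.
  apply/seteqP; split=> u //= [/far + /[!in_itv]/= /andP[yu ux]].
  by rewrite ler_normr => /orP[]; lra.
apply: (@zigzag_sum_diff_le _ _ _ n) => N nN.
rewrite -(big_mkord xpredT (fun k => zigzag k x - zigzag k y)).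
rewrite (@big_cat_nat _ _ _ n)//= big_nat big1 ?add0r; last first.
  by move=> k /andP[_ kn]; rewrite z0// subrr.
have B0 : 0 <= B by apply: le_trans gx; exact: capdist_ge0.
apply: le_trans (ler_norm_sum _ _ _) _.
apply: le_trans (ler_wpM2l B0 (sum_half_expn nN)).
rewrite mulr_sumr; apply: ler_sum_nat => k /andP[nk _]; rewrite div1r.
have := zle k x nk gx; have := zle k y nk gy.
by have := zigzag_ge0 k x; have := zigzag_ge0 k y; rewrite ler_norml; lra.
Qed.

Lemma lip_zigzag_sum_in n x : E_ n x -> strongly_one_sided_dense_at (E_ n) x ->
  lip zigzag_sum x = 1%:E.
Proof.
move=> Ex Dx; apply: lip_eq1 => [|e e0]; first exact: zigzag_sum_lip.
have [d d0 Hd] := zigzag_sum_ge Ex.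
(* Half of [e], because [zigzag_sum_ge] doubles the mass:
   [2 * (1 - e / 2) * r - r = (1 - e) * r]. *)
have e2 : 0 < e / 2 by rewrite divr_gt0.
have [d' d'0 Hd'] := strongly_one_sided_dense_mass (E_meas n) Dx e2.
exists (Num.min d d'); first by rewrite lt_min d0.
move=> r r0; rewrite lt_min => /andP[rd rd'].
have [H|H] := Hd' r r0 rd'.
  exists (x - r); first by rewrite opprB addrC subrK gtr0_norm.
  have := Hd (x - r); rewrite opprB [x + _]addrC subrK gtr0_norm//.
  move=> /(_ (ltW rd)); apply: le_trans.
  rewrite cumulB// ?ger0_norm ?mass_ge0//; lra.
exists (x + r); first by rewrite opprD addNKr normrN gtr0_norm.
have := Hd (x + r); rewrite opprD addNKr normrN gtr0_norm//.
move=> /(_ (ltW rd)); apply: le_trans.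
rewrite distrC cumulB// ?ger0_norm ?mass_ge0//; lra.
Qed.

Lemma lip_zigzag_sum_notin x : (forall n, ~ E_ n x) -> lip zigzag_sum x = 0%:E.
Proof.
move=> Ex; apply: lip_eq0 => [|e e0]; first exact: zigzag_sum_lip.
have gap_x n : 0 < gap n x.
  apply: capdist_gt0 => [|[k /= kn /Ex//]].
  by apply: closed_bigcup => // k _; exact: E_closed.
(* [e / 8] serves the radius [gap m x / 2], where the increment is at most [8 / 2 ^+ m] times the
   radius; [e ^+ 2 / 4] serves the radius [e / 2], where it is at most [2 / 2 ^+ m]. *)
have [m Hm] := @exists_half_expn_lt R (Num.min (e / 8) (e ^+ 2 / 4))
  ltac:(by rewrite lt_min !divr_gt0// exprn_gt0).
move: Hm; rewrite lt_min => /andP[m1 m2].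
(* The gaps at [x] need not tend to 0, so half the gap may be too large a radius. *)
have [me|em] := ltP (gap m x) e.
  exists (gap m x / 2); split; rewrite ?divr_gt0//; first by have := gap_x m; lra.
  move=> y xy; have gm := gap_x m.
  apply: le_trans (_ : 2 * gap m x * (2 / 2 ^+ m) <= _).
    apply: zigzag_sum_diff_gap; [lra|lra|].
    have := capdist_lip (\bigcup_(k in `I_m) E_ k) y x.
    by rewrite -!/(gap _ _) (distrC y); lra.
  have -> : 2 * gap m x * (2 / 2 ^+ m) = gap m x / 2 * (8 * (1 / 2 ^+ m)).
    by field; rewrite expf_neq0.
  by rewrite [leRHS]mulrC ler_pM2l; lra.
exists (e / 2); split; [lra|lra|] => y xy.
apply: le_trans (_ : 1 * (2 / 2 ^+ m) <= _).
  by apply: zigzag_sum_diff_gap; [lra|exact: capdist_le1|exact: capdist_le1].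
move: m2; rewrite expr2; lra.
Qed.

End ZigzagSum.

(** * The sum of zigzags as witness *)

Theorem theorem4p7 (R : realType) (E : set R) (E_ : nat -> set R)
    (E_disjoint : trivIset setT E_)
    (E_union : E = \bigcup_n E_ n)
    (E_closed : forall n : nat, closed (E_ n))
    (E_dense : forall n : nat, strongly_one_sided_dense (E_ n)) :
  lip1 E.
Proof.
exists (zigzag_sum E_); split => [x|x].
  apply/cvgrPdist_lt => e e0; near=> y.
  apply: le_lt_trans (zigzag_sum_lip E_disjoint E_closed x y) _.
  by near: y; exact: cvgr_dist_lt.
rewrite E_union indicE; have [|Ex] := boolP (x \in _).
  rewrite inE => -[n _ Enx].
  by rewrite (lip_zigzag_sum_in E_disjoint E_closed Enx)//; exact: E_dense.
rewrite (lip_zigzag_sum_notin E_disjoint E_closed)// => n Enx.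
by move: Ex; rewrite notin_setE; apply; exists n.
Unshelve. all: by end_near. Qed.
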